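(* Let $\mathcal{J}$ be a countably generated ideal on $\omega$. Let $A=(a_{n,k}:n,k\in\omega)$ be an infinite real matrix such that $\sum_k|a_{n,k}|<\infty$ for all $n\in\omega$ and $$\forall E\subseteq\omega,\quad \mathcal{J}\text{-}\lim_n\sum_{k\in E}a_{n,k}=0.$$ Then $\mathcal{J}\text{-}\lim_n\sum_k|a_{n,k}|=0$.
   Context: $\omega$ is the set of nonnegative integers. An ideal on $\omega$ is a family of subsets of $\omega$ closed under subsets and finite unions; every ideal is assumed to contain all finite sets and to differ from the power set of $\omega$. An ideal $\mathcal{J}$ is countably generated if there is a sequence $(Q_j)$ of subsets of $\omega$ such that $S\in\mathcal{J}$ iff $S\subseteq\bigcup_{j\in F}Q_j$ for some finite $F\subseteq\omega$. $\mathcal{J}\text{-}\lim_nx_n=\eta$ means $\{n:x_n\notin U\}\in\mathcal{J}$ for every neighborhood $U$ of $\eta$. *)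

(* Defs.v *)
From mathcomp Require Import all_boot all_order all_algebra.
From mathcomp Require Import all_classical all_reals all_analysis.

Set Implicit Arguments.
Unset Strict Implicit.
Unset Printing Implicit Defensive.

Import Order.TTheory GRing.Theory Num.Theory.
Import numFieldNormedType.Exports.

Local Open Scope classical_set_scope.

Record is_ideal (J : set (set nat)) : Prop := IsIdeal {
  ideal_subset : forall S T : set nat, S `<=` T -> J T -> J S ;
  ideal_union : forall S T : set nat, J S -> J T -> J (S `|` T) ;
  ideal_finite : forall S : set nat, finite_set S -> J S ;
  ideal_proper : ~ J [set: nat] }.

Definition countably_generated (J : set (set nat)) : Prop :=
  exists Q : nat -> set nat, forall S : set nat,
    J S <-> exists2 F : set nat, finite_set F & S `<=` \bigcup_(j in F) Q j.

Definition ideal_lim (T : topologicalType) (J : set (set nat))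
    (x : nat -> T) (eta : T) : Prop :=
  forall U : set T, nbhs eta U -> J [set n | ~ U (x n)].

(* Main.v *)
Require Import Defs.
From mathcomp Require Import all_boot all_order all_algebra.
From mathcomp Require Import all_classical all_reals all_analysis.
From mathcomp Require Import lra.

Set Implicit Arguments.
Unset Strict Implicit.
Unset Printing Implicit Defensive.

Import Order.TTheory GRing.Theory Num.Theory.
Import numFieldNormedType.Exports.

Local Open Scope classical_set_scope.
Local Open Scope ring_scope.

(** The proof is a gliding hump. Since the ideal is countably generated, it has
    a cofinal sequence [P] of members ([countably_generated_sequence]), so a set
    escaping every [P m] is outside the ideal; this lets countably many steps
    witness non-membership.

    Suppose that the rows of [l^1]-norm at least [e] form a set outside the
    ideal. Applying the hypothesis to singletons, every fixed initial piece of
    the rows tends to 0 along the ideal ([head_small]). Hence one can choose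
    successively rows [row i] outside [P i], of norm at least [e], and
    cut points [K 0 <= K 1 <= ...] such that almost all the mass of [row i] lies
    on the block of columns from [K i] to [K i.+1]: its mass before [K i] is
    small by the choice of the row, and its tail is then made small by the choice
    of [K i.+1].

    As the blocks are disjoint, a single set [E] of columns can record the sign
    pattern of every [row i] on its own block ([block_sign_set]). On that block
    the absolute values sum to the sum over [E] minus the sum over its
    complement, so these two sums cannot both be small for a row of norm at
    least [e] ([norm_sum_le_of_sign_on_block]). But by hypothesis both are small
    outside some [P m], which [row m] escapes: a contradiction. *)

Lemma ideal_lim0P (R : realType) (J : set (set nat)) (x : nat -> R) :
  is_ideal J ->
  ideal_lim (T := R) J x 0 <->
  (forall d : R, 0 < d -> J [set n | d <= `|x n|]).
Proof.
move=> J_ideal; split=> [x0 d d0|xJ U /nbhs_ballP[d /= d0 dU]].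
  have /x0 : nbhs (0 : R) (ball (0 : R) d) by exact: nbhsx_ballx.
  apply: (ideal_subset J_ideal) => n /= dx.
  by rewrite -ball_normE /= sub0r normrN; apply/negP; rewrite -leNgt.
apply: (ideal_subset J_ideal) (xJ _ d0) => n /= nU.
rewrite leNgt; apply/negP => xd; apply: nU; apply: dU.
by rewrite -ball_normE /= sub0r normrN.
Qed.

(** The sets are the finite unions of the first generators: a finite set of
    indices is contained in an initial segment. *)
Lemma countably_generated_sequence (J : set (set nat)) :
  countably_generated J ->
  exists2 P : nat -> set nat,
    forall m, J (P m) & forall S, J S -> exists m, S `<=` P m.
Proof.
move=> [Q QJ]; exists (fun m => \bigcup_(j in `I_m) Q j) => [m|S].
  by apply/QJ; exists `I_m => //; exact: finite_II.
move=> /QJ[F Ffin SF].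
have [m Fm] : exists m, F `<=` `I_m.
  have [X FX] := finite_fsetP.1 Ffin.
  exists (\max_(i <- finmap.enum_fset X) i).+1 => i; rewrite FX /= => iX.
  by rewrite ltnS; exact: (leq_bigmax_seq (F := id)).
by exists m; apply: (subset_trans SF); exact: bigcup_subset.
Qed.

Lemma cvg_subseries (R : realType) (u : nat -> R) (E : set nat) :
  cvgn (series (fun k => `|u k|)) ->
  cvgn (fun N => \sum_(0 <= k < N | k \in E) u k).
Proof.
move=> u_sum.
under eq_fun do rewrite big_mkcond.
apply: (normed_cvg (u_ := fun k => if k \in E then u k else 0)).
by apply: series_le_cvg u_sum => k //=; case: ifP => //; rewrite normr0.
Qed.

(** Adding the terms of [E] and subtracting the others gives the sum of a signed
    copy of [u]. Its terms agree with the absolute values on the block, and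
    elsewhere the discrepancy at [k] is at most [2 * `|u k|]. *)
Lemma sum_norm_le_of_sign_on_block (R : realType) (u : nat -> R)
    (E : set nat) (K L N : nat) :
  (K <= L <= N)%N ->
  (forall k, (K <= k < L)%N -> k \in E = (0 <= u k)) ->
  \sum_(0 <= k < N) `|u k| <=
    \sum_(0 <= k < N | k \in E) u k - \sum_(0 <= k < N | k \in ~` E) u k
    + 2 * (\sum_(0 <= k < K) `|u k| + \sum_(L <= k < N) `|u k|).
Proof.
move=> /andP[KL LN] E_sign.
pose d k := `|u k| - (if k \in E then u k else - u k).
have d_le k : d k <= 2 * `|u k|.
  rewrite /d; have := ler_norm (u k); have := ler_norm (- u k).
  by rewrite normrN; case: ifP => _; lra.
have d_block k : (K <= k < L)%N -> d k = 0.
  move=> /E_sign; rewrite /d => ->; case: ifPn => [u0|].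
    by rewrite ger0_norm ?subrr.
  by rewrite -ltNge => u0; rewrite ltr0_norm ?subrr.
rewrite -lerBlDl.
have -> : \sum_(0 <= k < N) `|u k| - (\sum_(0 <= k < N | k \in E) u k -
    \sum_(0 <= k < N | k \in ~` E) u k) = \sum_(0 <= k < N) d k.
  (* Restricted sums become full sums of terms extended by 0, which can then be
     subtracted termwise. *)
  rewrite 2![in X in X = _](big_mkcond (fun k => k \in _)) /= -!sumrB.
  apply: eq_bigr => k _; rewrite /d in_setC.
  by case: (k \in E); rewrite /= ?subr0 ?sub0r.
rewrite (big_cat_nat (n := K)) //=; last exact: leq_trans KL LN.
rewrite (big_cat_nat (m := K) (n := L)) //=.
rewrite [X in _ + (X + _)]big_nat_cond [X in _ + (X + _)]big1 ?add0r; last first.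
  by move=> k; rewrite andbT => /d_block.
rewrite mulrDr !mulr_sumr; apply: lerD; exact: ler_sum.
Qed.

(** The limit of the finite inequality; the mass beyond the block becomes the
    remainder of the series. *)
Lemma norm_sum_le_of_sign_on_block (R : realType) (u : nat -> R)
    (E : set nat) (K L : nat) :
  cvgn (series (fun k => `|u k|)) -> (K <= L)%N ->
  (forall k, (K <= k < L)%N -> k \in E = (0 <= u k)) ->
  limn (series (fun k => `|u k|)) <=
    `|limn (fun N => \sum_(0 <= k < N | k \in E) u k)|
    + `|limn (fun N => \sum_(0 <= k < N | k \in ~` E) u k)|
    + 2 * (series (fun k => `|u k|) K
           + (limn (series (fun k => `|u k|)) - series (fun k => `|u k|) L)).
Proof.
move=> u_sum KL E_sign.
set s := series _; set p := fun N => _; set q := fun N => \sum_(_ <= _ < _ | _) _.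
have p_cvg : cvgn p by exact: cvg_subseries.
have q_cvg : cvgn q by exact: cvg_subseries.
suff : limn s <= limn p - limn q + 2 * (s K + (limn s - s L)).
  by have := ler_norm (limn p); have := ler_norm (- limn q); rewrite normrN; lra.
have rhs_cvg : (fun N => p N - q N + 2 * (s K + (s N - s L))) @ \oo -->
    limn p - limn q + 2 * (s K + (limn s - s L)).
  apply: cvgD; first exact: cvgB.
  apply: cvgMr; apply: cvgD; first exact: cvg_cst.
  by apply: cvgB => //; exact: cvg_cst.
rewrite -(cvg_lim _ rhs_cvg) //; apply: ler_lim => //.
  by apply/cvg_ex; eexists; exact: rhs_cvg.
near=> N.
have LN : (L <= N)%N by near: N; exact: nbhs_infty_ge.
have := @sum_norm_le_of_sign_on_block R u E K L N.
rewrite KL LN => /(_ isT E_sign).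
suff -> : \sum_(L <= k < N) `|u k| = s N - s L by [].
by rewrite /s sub_series_geq.
Unshelve. all: by end_near. Qed.

Lemma column_small (R : realType) (J : set (set nat)) (a : nat -> nat -> R)
    (J_ideal : is_ideal J)
    (a_lim : forall E : set nat,
      ideal_lim (T := R) J
        (fun n => limn (fun N => \sum_(0 <= k < N | k \in E) a n k)) 0)
    (k : nat) (d : R) :
  0 < d -> J [set n | d <= `|a n k|].
Proof.
move=> d0; have /(ideal_lim0P _ J_ideal) /(_ _ d0) := a_lim [set k].
apply: (ideal_subset J_ideal) => n /=.
suff -> : limn (fun N => \sum_(0 <= j < N | j \in [set k]) a n j) = a n k by [].
apply: cvg_lim => //; apply: (cvg_near_cst (a n k)).
near=> N; have kN : (k < N)%N by near: N; exact: nbhs_infty_gt.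
rewrite (eq_bigl (fun j => j == k)); last first.
  by move=> j; apply/idP/eqP; rewrite inE.
by rewrite big_nat1_eq kN.
Unshelve. all: by end_near. Qed.

Lemma head_small (R : realType) (J : set (set nat)) (a : nat -> nat -> R)
    (J_ideal : is_ideal J)
    (a_lim : forall E : set nat,
      ideal_lim (T := R) J
        (fun n => limn (fun N => \sum_(0 <= k < N | k \in E) a n k)) 0)
    (K : nat) (d : R) :
  0 < d -> J [set n | d <= series (fun k => `|a n k|) K].
Proof.
elim: K d => [|K IH] d d0.
  apply: (ideal_subset J_ideal) (ideal_finite J_ideal (finite_set0 _)) => n /=.
  by rewrite /series /= big_geq // leNgt d0.
have d2 : 0 < d / 2 by rewrite divr_gt0.
apply: (ideal_subset J_ideal) (ideal_union J_ideal (IH _ d2)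
  (column_small J_ideal a_lim K d2)).
move=> n /=; rewrite seriesSr => dn.
by have [|] := leP (d / 2) (series (fun k => `|a n k|) K); [left|right; lra].
Qed.

(** Prescriptions on distinct blocks cannot conflict, because a nondecreasing
    sequence of cut points makes the blocks disjoint. *)
Lemma block_sign_set (s : nat -> nat -> bool) (K : nat -> nat) :
  {homo K : i j / (i <= j)%N} ->
  exists E : set nat,
    forall i k, (K i <= k < K i.+1)%N -> k \in E = s i k.
Proof.
move=> K_mono.
exists [set k | exists2 i, (K i <= k < K i.+1)%N & s i k] => i k kI.
apply/idP/idP => [|ski]; last by rewrite inE; exists i.
rewrite inE => -[j kJ]; suff -> : j = i by [].
move: kI kJ => /andP[ik ki] /andP[jk kj]; apply/eqP; rewrite eqn_leq.
apply/andP; split; rewrite leqNgt; apply/negP => /K_mono ij.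
  by have := leq_trans ki (leq_trans ij jk); rewrite ltnn.
by have := leq_trans kj (leq_trans ij ik); rewrite ltnn.
Qed.

Theorem theorem4p6 (R : realType) (J : set (set nat)) (a : nat -> nat -> R)
    (J_ideal : is_ideal J) (J_cg : countably_generated J)
    (a_summable : forall n : nat, cvgn (series (fun k => `|a n k|)))
    (a_lim : forall E : set nat,
      ideal_lim (T := R) J
        (fun n => limn (fun N => \sum_(0 <= k < N | k \in E) a n k)) 0) :
  ideal_lim (T := R) J (fun n => limn (series (fun k => `|a n k|))) 0.
Proof.
pose s n := series (fun k => `|a n k|).
have s_ge0 n : 0 <= limn (s n).
  apply: limr_ge; first exact: a_summable.
  by near=> N; exact: sumr_ge0.
apply/(ideal_lim0P _ J_ideal) => e e0; apply: contrapT => BJ.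
have [P PJ P_cofinal] := countably_generated_sequence J_cg.
(* Head and tail masses count twice, and the two sums over a set and its
   complement will be below e / 4: altogether less than
   2 * (e / 16 + e / 16) + 2 * (e / 4) = 3 * e / 4. *)
have d0 : 0 < e / 16 by rewrite divr_gt0.
have step m K : exists nL : nat * nat,
    [/\ ~ P m nL.1, e <= limn (s nL.1), s nL.1 K < e / 16,
        (K <= nL.2)%N & limn (s nL.1) - s nL.1 nL.2 < e / 16].
  (* Otherwise the rows of large norm would be covered by two members of J. *)
  have [n [Bn Pn head_n]] : exists n,
      [/\ e <= limn (s n), ~ P m n & s n K < e / 16].
    apply: contrapT => noN; apply: BJ.
    apply: (ideal_subset J_ideal) (ideal_union J_ideal (PJ m)
      (head_small J_ideal a_lim K d0)) => n /=; rewrite (ger0_norm (s_ge0 n)) => Bn.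
    have [|Pn] := pselect (P m n); [by left|right].
    by rewrite leNgt; apply/negP => head_n; apply: noN; exists n.
  have s_near : \forall L \near \oo, `|limn (s n) - s n L| < e / 16.
    have s_cvg : s n @ \oo --> limn (s n) by exact: a_summable.
    exact: (cvgrPdist_lt _ _).1 s_cvg _ d0.
  have [L [KL tail_n]] : exists L, (K <= L)%N /\ `|limn (s n) - s n L| < e / 16.
    have [M _ sM] := s_near; exists (maxn K M); split; first exact: leq_maxl.
    by apply: sM; exact: leq_maxr.
  by exists (n, L); split => //=; apply: le_lt_trans tail_n; exact: ler_norm.
have [f fP] := choice (fun mK : nat * nat => step mK.1 mK.2).
(* Each cut point depends on the previous row, which itself depends on the
   previous cut point: one recursion produces both. *)
pose fix K i := if i is j.+1 then (f (j, K j)).2 else 0%N.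
pose row i := (f (i, K i)).1.
have K_mono : {homo K : i j / (i <= j)%N}.
  apply: homo_leq => // [i j k|i]; first exact: leq_trans.
  by have [] := fP (i, K i).
have [E E_sign] := block_sign_set (fun i k => 0 <= a (row i) k) K_mono.
have e4 : 0 < e / 4 by rewrite divr_gt0.
have EJ := (ideal_lim0P _ J_ideal).1 (a_lim E) _ e4.
have CJ := (ideal_lim0P _ J_ideal).1 (a_lim (~` E)) _ e4.
have [m mP] := P_cofinal _ (ideal_union J_ideal EJ CJ).
(* The index of the covering set P m selects the row that escapes it. *)
have [/= Pm Bm head_m KL tail_m] := fP (m, K m).
have := norm_sum_le_of_sign_on_block (a_summable (row m)) KL (E_sign m).
rewrite -/(s _) -/(row m).
have small x : [set n | e / 4 <= x n] `<=` P m -> x (row m) < e / 4.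
  by move=> xP; rewrite ltNge; apply/negP => /xP.
have := small _ (subset_trans (@subsetUl _ _ _) mP).
have := small _ (subset_trans (@subsetUr _ _ _) mP).
move: Bm head_m tail_m; rewrite -/(row m) /=.
lra.
Unshelve. all: by end_near. Qed.
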